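(* $f(321)\ge 333$. Consequently, Borsuk's conjecture fails in every dimension $n\ge 321$, i.e. $f(n)>n+1$ for all $n\ge 321$.
   Context: For $n\ge 1$, $f(n)$ denotes the smallest integer $f$ such that every bounded set in $\mathbb{R}^n$ can be partitioned into at most $f$ subsets each of strictly smaller diameter than the original set. Borsuk's conjecture asserts $f(n)=n+1$ for all $n\ge1$. (It is known from prior work that $f(n)>n+1$ for all $n\ge 323$.) *)

(* Defs.v *)
From mathcomp Require Import all_boot all_order all_algebra.
From mathcomp Require Import classical_sets boolp reals ereal Rstruct.
From Stdlib Require Import Rdefinitions.
Set Implicit Arguments. Unset Strict Implicit. Unset Printing Implicit Defensive.
Import Order.TTheory GRing.Theory Num.Theory.
Local Open Scope classical_set_scope.
Local Open Scope ring_scope.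

Definition point (n : nat) := 'rV[Rdefinitions.R]_n.

Definition edist (n : nat) (x y : point n) : Rdefinitions.R :=
  Num.sqrt (\sum_(i < n) (x ord0 i - y ord0 i) ^+ 2).

(* Diameter of a set, as an extended real (sup of pairwise distances);
   the empty set has diameter -oo. *)
Definition diam (n : nat) (A : set (point n)) : \bar Rdefinitions.R :=
  ereal_sup [set (edist x y)%:E | x in A & y in A].

Definition bounded_set (n : nat) (S : set (point n)) : Prop :=
  exists M : Rdefinitions.R, forall x y, S x -> S y -> edist x y <= M.

(* S can be partitioned into (at most) k subsets each of strictly smaller
   diameter than S (parts are allowed to be empty, which is the same as
   using fewer than k parts). *)
Definition smaller_diam_partition (n k : nat) (S : set (point n)) : Prop :=
  exists A : 'I_k -> set (point n),
    [/\ (forall i, A i `<=` S),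
        (forall x, S x -> exists i, A i x),
        (forall i j x, A i x -> A j x -> i = j)
      & (forall i, (diam (A i) < diam S)%E)].

(* Every bounded set in R^n (with at least two points) can be partitioned
   into at most k subsets of strictly smaller diameter.  f(n) is the least
   such k, so "f(n) >= m" means this fails for every k < m. *)
Definition borsuk_partitionable (n k : nat) : Prop :=
  forall S : set (point n), bounded_set S ->
    (exists x y, S x /\ S y /\ x <> y) ->
    smaller_diam_partition k S.

(* Main.v *)
(** Bondarenko's two-distance set: the strongly regular graph G_2(4), with
    parameters (416, 100, 36, 20), is represented by 416 points on a sphere in
    R^65, the nonadjacent pairs being the ones at maximal distance.  A part of
    smaller diameter is therefore a clique, and cliques have at most 5 elements,
    so at least 84 parts are needed.  A cone over a spherical set whose radius is
    less than its diameter divided by sqrt 2 is again such a set, one dimension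
    higher, and it needs one part more; hence f(n) >= n + 19 for all n >= 65.

    Vertex-transitivity reduces the counting of common neighbors and the clique
    bound to computations around a single vertex. *)

From Stdlib Require Import Rdefinitions.
From mathcomp Require Import all_boot all_order all_algebra.
From mathcomp Require Import zify ring lra.
From mathcomp Require Import classical_sets boolp reals ereal Rstruct.
Require Import Defs.
Set Implicit Arguments. Unset Strict Implicit. Unset Printing Implicit Defensive.
Import Order.TTheory GRing.Theory Num.Theory.

(** * Explicit tables for the graph and one of its automorphisms *)

(* The isotropic points of the Hermitian plane over GF(16) form five orbits of
   length 13 under an element of order 13 of U(3,4).  Each of the 416 orthogonal
   triangles of nonisotropic points is given by the 15 isotropic points on its
   sides; triangles are adjacent when they share exactly 3 of these points.
   Entry [a] lists, orbit by orbit, the points of a representative of the [a]-th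
   of the 32 orbits on triangles; [(a, b)] is its [b]-th translate. *)
Definition base_blocks : seq (seq (seq nat)) := [::
  [:: [:: 0; 1; 4; 7; 10]; [:: 0; 2; 4]; [:: 0; 4; 7; 11; 12]; [:: 6]; [:: 2]];
  [:: [:: 3]; [:: 2; 3; 6; 7; 11]; [:: 5; 6; 8; 10; 11]; [:: 2; 8; 9]; [:: 11]];
  [:: [:: 1; 4; 6; 12]; [:: 1; 3; 4; 5; 7]; [:: 1; 4; 11]; [:: 8]; [:: 10; 11]];
  [:: [:: 2; 5; 9]; [:: 3; 6; 8]; [:: 4; 5; 8]; [:: 0; 8]; [:: 2; 4; 5; 8]];
  [:: [:: 0; 1; 3; 4]; [:: 2; 5; 8; 10; 12]; [:: 3; 11]; [:: 1]; [:: 8; 10; 12]];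
  [:: [:: 0; 4; 6]; [:: 2; 3; 5]; [:: 5; 8; 10; 12]; [:: 11; 12]; [:: 2; 4; 10]];
  [:: [:: 0; 4; 11]; [:: 2; 4; 5]; [:: 2; 4; 6; 9]; [:: 3; 4]; [:: 3; 5; 10]];
  [:: [:: 1; 5; 8]; [:: 5; 7; 10]; [:: 2; 3; 12]; [:: 0; 8]; [:: 5; 8; 9; 11]];
  [:: [:: 3; 4; 11]; [:: 3; 10]; [:: 2; 3; 12]; [:: 4; 5; 7]; [:: 3; 6; 7; 8]];
  [:: [:: 7; 11; 12]; [:: 8; 12]; [:: 3; 5; 6; 11]; [:: 1; 9; 12]; [:: 0; 6; 11]];
  [:: [:: 1; 2; 3; 4; 9]; [:: 4]; [:: 4; 11]; [:: 0; 3; 4; 12]; [:: 4; 9; 12]];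
  [:: [:: 3; 11; 12]; [:: 1; 5]; [:: 1; 2; 4; 9]; [:: 7; 9; 12]; [:: 0; 2; 7]];
  [:: [:: 3; 8; 11]; [:: 11]; [:: 1; 2; 4; 8; 12]; [:: 0; 1; 2; 3; 4]; [:: 11]];
  [:: [:: 3; 6; 7; 8; 11]; [:: 2]; [:: 0; 11; 12]; [:: 0; 5; 7; 12]; [:: 0; 4]];
  [:: [:: 6; 7; 12]; [:: 3; 10]; [:: 4; 5; 8]; [:: 1; 3; 4]; [:: 5; 6; 7; 10]];
  [:: [:: 1; 3; 5; 7; 12]; [:: 1; 8; 11]; [:: 8]; [:: 2]; [:: 3; 6; 10; 11; 12]];
  [:: [:: 1; 2; 6; 8]; [:: 1; 2; 7; 12]; [:: 2; 8; 10]; [:: 5; 8; 10; 12]; [::]];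
  [:: [:: 2; 3; 5; 7; 8]; [:: 1; 5; 8; 12]; [:: 3; 4; 10]; [::]; [:: 0; 4; 9]];
  [:: [:: 2; 4; 8; 9]; [:: 1; 6; 11; 12]; [:: 5; 10; 12]; [:: 0; 3; 9; 11]; [::]];
  [:: [:: 2; 4]; [:: 2; 10; 11]; [:: 2; 3; 6]; [:: 0; 7; 11]; [:: 0; 4; 9; 10]];
  [:: [:: 7; 9]; [:: 3; 4; 12]; [:: 2; 5; 6]; [:: 2; 9; 11]; [:: 1; 4; 5; 10]];
  [:: [:: 12]; [:: 7]; [:: 2; 6; 9; 10; 11; 12]; [:: 11]; [:: 3; 4; 6; 8; 10; 11]];
  [:: [:: 3; 4; 7; 11]; [:: 7; 8; 9; 12]; [::]; [:: 1; 3; 4; 7]; [:: 1; 4; 5]];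
  [:: [::]; [:: 1; 5; 7; 8; 10]; [:: 3; 6; 11]; [:: 2; 3; 7; 8]; [:: 0; 1; 2]];
  [:: [:: 1; 5; 8; 9]; [:: 3; 6; 7; 8]; [::]; [:: 3; 6; 7; 9]; [:: 1; 10; 11]];
  [:: [:: 1; 4]; [:: 4; 11; 12]; [:: 4; 5; 9; 11]; [:: 1; 7; 11]; [:: 0; 5; 7]];
  [:: [:: 1; 4]; [:: 4; 9; 10]; [:: 4; 6; 10; 11]; [:: 2; 5; 9]; [:: 1; 3; 8]];
  [:: [:: 5]; [:: 2; 4; 9; 11]; [:: 1; 6; 10]; [:: 0; 1; 4; 7; 8]; [:: 5; 8]];
  [:: [:: 3; 5; 6; 8]; [::]; [:: 2; 4; 6]; [:: 3; 6; 10; 11; 12]; [:: 4; 7; 10]];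
  [:: [:: 1]; [:: 2; 3; 8; 9; 10]; [:: 6]; [:: 0; 4; 9]; [:: 6; 7; 9; 11; 12]];
  [:: [:: 6]; [:: 4; 7; 8; 11]; [:: 10; 12]; [:: 3; 5; 7; 11; 12]; [:: 1; 7; 8]];
  [:: [:: 3; 4; 5]; [:: 12]; [:: 9]; [:: 0; 3; 6; 8; 11]; [:: 3; 5; 6; 8; 12]]].

(* The action on triangles of a unitary transvection. *)
Definition involution_table : seq (seq (nat * nat)) := [::
  [:: (0, 0); (6, 5); (4, 4); (2, 12); (1, 4); (3, 6); (1, 10);
      (7, 10); (1, 3); (2, 9); (4, 5); (5, 4); (0, 12)];
  [:: (8, 0); (13, 0); (12, 12); (0, 8); (0, 4); (12, 8); (13, 12);
      (14, 3); (11, 6); (10, 2); (0, 6); (10, 6); (9, 10)];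
  [:: (15, 4); (7, 12); (9, 4); (18, 3); (4, 11); (16, 0); (11, 12);
      (3, 4); (15, 3); (0, 9); (17, 2); (17, 1); (0, 3)];
  [:: (19, 12); (22, 4); (23, 10); (21, 3); (2, 7); (20, 1); (0, 5);
      (7, 9); (7, 8); (10, 3); (15, 11); (18, 5); (14, 5)];
  [:: (5, 0); (8, 12); (17, 4); (24, 9); (0, 2); (0, 10); (22, 5);
      (17, 12); (14, 4); (6, 9); (15, 12); (2, 4); (15, 8)];
  [:: (4, 0); (9, 9); (6, 7); (23, 9); (0, 11); (26, 10); (25, 1);
      (6, 2); (21, 11); (22, 2); (15, 5); (16, 8); (13, 1)];
  [:: (24, 12); (21, 4); (5, 7); (26, 7); (25, 11); (0, 1); (23, 5);
      (5, 2); (11, 7); (4, 9); (13, 11); (18, 8); (15, 2)];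
  [:: (21, 12); (23, 4); (24, 10); (20, 3); (8, 11); (16, 11); (15, 9);
      (10, 5); (3, 8); (3, 7); (0, 7); (19, 1); (2, 1)];
  [:: (1, 0); (21, 8); (8, 2); (29, 9); (19, 7); (27, 12); (24, 7);
      (16, 6); (19, 10); (14, 7); (28, 5); (7, 4); (4, 1)];
  [:: (30, 0); (28, 7); (9, 2); (22, 1); (2, 2); (26, 6); (11, 10);
      (21, 5); (16, 10); (5, 1); (1, 12); (26, 4); (29, 10)];
  [:: (29, 6); (23, 8); (1, 9); (3, 9); (27, 8); (7, 7); (1, 11);
      (23, 6); (29, 5); (25, 9); (24, 4); (22, 10); (26, 12)];
  [:: (24, 0); (11, 1); (28, 8); (30, 1); (29, 1); (25, 4); (1, 8);
      (6, 8); (18, 6); (21, 10); (9, 6); (25, 2); (2, 6)];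
  [:: (30, 12); (19, 4); (12, 2); (25, 8); (26, 0); (12, 5); (20, 11);
      (30, 2); (1, 5); (27, 6); (12, 10); (27, 10); (1, 2)];
  [:: (1, 1); (5, 12); (16, 12); (29, 4); (23, 12); (20, 4); (30, 7);
      (19, 11); (23, 2); (29, 7); (18, 4); (6, 10); (1, 6)];
  [:: (29, 2); (14, 1); (21, 7); (1, 7); (4, 8); (3, 12); (28, 10);
      (8, 9); (20, 5); (18, 10); (22, 7); (27, 4); (20, 8)];
  [:: (29, 8); (15, 1); (6, 12); (2, 8); (2, 0); (5, 10); (15, 6);
      (29, 3); (4, 12); (7, 6); (29, 12); (3, 10); (4, 10)];
  [:: (2, 5); (16, 2); (16, 1); (25, 3); (20, 9); (16, 5); (8, 7);
      (16, 7); (5, 11); (27, 11); (9, 8); (7, 5); (13, 2)];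
  [:: (25, 5); (2, 11); (2, 10); (26, 3); (4, 2); (17, 5); (17, 6);
      (20, 10); (17, 8); (19, 5); (17, 10); (17, 11); (4, 7)];
  [:: (26, 5); (18, 2); (18, 1); (2, 3); (13, 10); (3, 11); (11, 8);
      (27, 5); (6, 11); (18, 9); (14, 9); (18, 11); (19, 6)];
  [:: (30, 11); (7, 11); (22, 3); (31, 5); (12, 1); (17, 9); (18, 12);
      (8, 4); (21, 6); (19, 9); (8, 8); (13, 7); (3, 0)];
  [:: (24, 11); (3, 5); (30, 3); (7, 3); (13, 5); (14, 8); (20, 6);
      (21, 9); (14, 12); (16, 4); (17, 7); (12, 6); (31, 0)];
  [:: (25, 7); (21, 1); (26, 1); (3, 3); (6, 1); (9, 7); (19, 8);
      (14, 2); (8, 1); (20, 7); (11, 9); (5, 8); (7, 0)];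
  [:: (22, 8); (9, 3); (5, 9); (19, 2); (3, 1); (4, 6); (22, 6);
      (14, 10); (22, 0); (22, 9); (10, 11); (25, 10); (30, 5)];
  [:: (28, 6); (28, 9); (13, 8); (28, 2); (7, 1); (6, 6); (10, 7);
      (28, 1); (10, 1); (5, 3); (3, 2); (28, 0); (13, 4)];
  [:: (11, 0); (24, 6); (30, 9); (26, 11); (10, 10); (24, 5); (24, 1);
      (8, 6); (24, 8); (4, 3); (7, 2); (20, 0); (6, 0)];
  [:: (31, 3); (5, 6); (11, 11); (16, 3); (11, 5); (17, 0); (27, 2);
      (21, 0); (12, 3); (10, 9); (22, 11); (6, 4); (25, 12)];
  [:: (12, 4); (21, 2); (27, 1); (17, 3); (9, 11); (18, 0); (9, 5);
      (6, 3); (31, 2); (26, 9); (5, 5); (24, 3); (10, 12)];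
  [:: (28, 12); (26, 2); (25, 6); (28, 3); (14, 11); (18, 7); (12, 9);
      (31, 11); (10, 4); (31, 7); (12, 11); (16, 9); (8, 5)];
  [:: (23, 11); (23, 7); (23, 3); (27, 3); (30, 6); (8, 10); (23, 0);
      (9, 1); (11, 2); (23, 1); (14, 6); (30, 8); (27, 0)];
  [:: (31, 12); (11, 4); (14, 0); (15, 7); (13, 3); (10, 8); (10, 0);
      (13, 9); (15, 0); (8, 3); (9, 12); (31, 6); (15, 10)];
  [:: (9, 0); (11, 3); (12, 7); (20, 2); (31, 1); (22, 12); (28, 4);
      (13, 6); (28, 11); (24, 2); (31, 4); (19, 0); (12, 0)];
  [:: (20, 12); (30, 4); (26, 8); (25, 0); (30, 10); (19, 3); (29, 11);
      (27, 9); (31, 8); (31, 9); (31, 10); (27, 7); (29, 0)]].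

(** Translating both triangles by the same amount preserves the number of shared points, so only the
    relative shift [d] matters. *)
Definition shifted_meet (d : nat) (s t : seq (seq nat)) : nat :=
  sumn [seq count (fun y => has (eqn ((y + d) %% 13)) p.1) p.2 | p <- zip s t].

Definition adjacency_row (s t : seq (seq nat)) : seq bool :=
  [seq eqn (shifted_meet d s t) 3 | d <- iota 0 13].

(* Rows are doubled so that [v.2 - u.2] modulo 13 can be looked up without a
   modulo operation. *)
Definition adjacency_table : seq (seq (seq bool)) :=
  [seq [seq let r := adjacency_row s t in r ++ r | t <- base_blocks]
      | s <- base_blocks].

Definition nat_adj (u v : nat * nat) : bool :=
  nth false (nth [::] (nth [::] adjacency_table u.1) v.1) (v.2 + 13 - u.2).

Definition nat_involution (u : nat * nat) : nat * nat :=
  nth u (nth [::] involution_table u.1) u.2.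

Definition nat_vertices : seq (nat * nat) :=
  [seq (a, b) | a <- iota 0 32, b <- iota 0 13].

Definition nat_neighbors0 : seq (nat * nat) :=
  [seq w <- nat_vertices | nat_adj (0, 0) w].

(** Exhaustive search for cliques listed in the order of the sequence: the outer recursion is on the
    size bound, the inner one on the choice of the first member. *)
Fixpoint cliques_le (T : Type) (e : rel T) (k : nat) : seq T -> bool :=
  if k is k'.+1 then
    fix loop (s : seq T) : bool :=
      if s is x :: s' then cliques_le e k' [seq y <- s' | e x y] && loop s' else true
  else fun s => if s is [::] then true else false.

Lemma nat_adj_involution_check :
  all (fun u => all (fun v =>
        eqb (nat_adj (nat_involution u) (nat_involution v)) (nat_adj u v))
      nat_vertices) nat_vertices = true.
Proof. by vm_cast_no_check (erefl true). Qed.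

Lemma nat_adj_sym_check :
  all (fun a => all (fun u => eqb (nat_adj u (a, 0)) (nat_adj (a, 0) u))
      nat_vertices) (iota 0 32) = true.
Proof. by vm_cast_no_check (erefl true). Qed.

Lemma nat_common_neighbors0_check :
  all (fun v => eqn (count (nat_adj v) nat_neighbors0)
        (if eqn v.1 0 && eqn v.2 0 then 100
         else if nat_adj (0, 0) v then 36 else 20)) nat_vertices = true.
Proof. by vm_cast_no_check (erefl true). Qed.

(** The bound is [4] because [(0, 0)] itself completes a clique among its neighbors to one of size
    at most 5. *)
Lemma nat_cliques0_check : cliques_le nat_adj 4 nat_neighbors0 = true.
Proof. by vm_cast_no_check (erefl true). Qed.

Lemma nat_involution_check :
  all (fun u => let v := nat_involution u in
                let w := nat_involution v in
         [&& v.1 < 32, v.2 < 13, eqn w.1 u.1 & eqn w.2 u.2]) nat_vertices = true.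
Proof. by vm_cast_no_check (erefl true). Qed.

Lemma nat_involution_descent_check :
  all (fun a => has (fun b => (nat_involution (a, b)).1 < a) (iota 0 13))
    (iota 1 31) = true.
Proof. by vm_cast_no_check (erefl true). Qed.

(** * Cliques and automorphisms of finite graphs *)

Lemma cliques_leP (T : eqType) (e : rel T) (k : nat) (s t : seq T) :
  cliques_le e k s -> subseq t s -> pairwise e t -> size t <= k.
Proof.
elim: k s t => [|k IHk] s t; first by case: s => // _; rewrite subseq0 => /eqP->.
elim: s t => [|x s IHs] [|y t] //= /andP[le_x le_s].
case: eqP => [-> sub_t /andP[xt pt]|_ sub_t pt]; last exact: (IHs (y :: t)).
by apply: IHk le_x _ pt; rewrite subseq_filter xt.
Qed.

Lemma cliques_le_map (T1 T2 : Type) (f : T1 -> T2) (e : rel T2) k s :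
  cliques_le e k (map f s) = cliques_le (relpre f e) k s.
Proof.
elim: k s => [|k IHk] s; first by case: s.
by elim: s => //= x s ->; rewrite filter_map IHk.
Qed.

Definition is_clique (V : finType) (e : rel V) (K : {set V}) : Prop :=
  {in K &, forall x y, x != y -> e x y}.

Definition common_neighbors (V : finType) (e : rel V) (u v : V) : nat :=
  #|[pred w | e u w && e v w]|.

Lemma cliques_le_card (V : finType) (e : rel V) k (s : seq V) (K : {set V}) :
  cliques_le e k s -> uniq s -> {subset K <= s} -> is_clique e K -> #|K| <= k.
Proof.
move=> le_s Us Ks clK; pose t := [seq x <- s | x \in K].
have Ut : uniq t by rewrite filter_uniq.
have tK : t =i K.
  by move=> x; rewrite mem_filter andb_idr //; apply: Ks.
have -> : #|K| = size t.
  by rewrite -(card_uniqP Ut); apply: eq_card => x; rewrite tK.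
apply: (cliques_leP le_s) (filter_subseq _ _) _; rewrite -/t.
(* Uniqueness means pairwise distinct, and distinct members of a clique are adjacent. *)
move: Ut; rewrite uniq_pairwise; apply: (@sub_in_pairwise _ (mem K)).
  by move=> x y xK yK /= ; apply: clK.
by apply/allP=> x; rewrite tK.
Qed.

Section Automorphisms.
Variables (V : finType) (e : rel V) (f : V -> V).
Hypotheses (f_inj : injective f) (fe : forall x y, e (f x) (f y) = e x y).

Lemma common_neighbors_aut u v :
  common_neighbors e (f u) (f v) = common_neighbors e u v.
Proof.
rewrite /common_neighbors -(card_image f_inj [pred w | e u w && e v w]).
(* An injective self-map of a finite type is onto, so every [w] is an image under [f]. *)
apply: eq_card => w; rewrite -[w](f_finv f_inj) inE !fe (fintype.mem_image f_inj).
by rewrite inE.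
Qed.

Lemma is_clique_preim (K : {set V}) : is_clique e K -> is_clique e (f @^-1: K).
Proof.
move=> clK x y; rewrite !inE => xK yK xy; rewrite -fe.
by apply: clK; rewrite // (inj_eq f_inj).
Qed.

End Automorphisms.

(** * The graph on 416 vertices: transitivity, parameters and clique bound *)

Definition vertex : finType := ('I_32 * 'I_13)%type.

Definition vertex0 : vertex := (ord0, ord0).

Definition nat_pair (u : vertex) : nat * nat := (val u.1, val u.2).

Definition adj : rel vertex := relpre nat_pair nat_adj.

Definition rotation (u : vertex) : vertex := (u.1, ordS u.2).

Definition involution (u : vertex) : vertex :=
  let v := nat_involution (nat_pair u) in (inord v.1, inord v.2).

Lemma nat_pair_inj : injective nat_pair.
Proof. by move=> [a b] [c d] [/val_inj-> /val_inj->]. Qed.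

Lemma mem_nat_pair u : nat_pair u \in nat_vertices.
Proof. by case: u => a b; apply: allpairs_f; rewrite mem_iota /=. Qed.

Definition vertices : seq vertex := [seq (a, b) | a <- enum 'I_32, b <- enum 'I_13].

Lemma nat_verticesE : nat_vertices = map nat_pair vertices.
Proof.
by rewrite /nat_vertices -!val_enum_ord allpairs_mapl allpairs_mapr map_allpairs.
Qed.

Lemma mem_vertices u : u \in vertices.
Proof. by case: u => a b; apply: allpairs_f; rewrite mem_enum. Qed.

Lemma vertices_uniq : uniq vertices.
Proof. by apply: allpairs_uniq; rewrite ?enum_uniq // => -[a b] [c d]. Qed.

Lemma card_count_vertices (P : pred vertex) : #|P| = count P vertices.
Proof.
rewrite -sum1_card -sum1_count; apply: perm_big; apply: uniq_perm.
- exact: index_enum_uniq.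
- exact: vertices_uniq.
by move=> u; rewrite mem_index_enum mem_vertices.
Qed.

Lemma nat_neighbors0E :
  nat_neighbors0 = map nat_pair [seq w <- vertices | adj vertex0 w].
Proof. by rewrite /nat_neighbors0 nat_verticesE filter_map. Qed.

Lemma nat_pair_involution u : nat_pair (involution u) = nat_involution (nat_pair u).
Proof.
have /allP/(_ _ (mem_nat_pair u)) := nat_involution_check.
case/and4P=> lt1 lt2 _ _.
by rewrite /involution /nat_pair /= !inordK // -surjective_pairing.
Qed.

Lemma involutionK : involutive involution.
Proof.
move=> u; apply: nat_pair_inj; rewrite !nat_pair_involution.
have /allP/(_ _ (mem_nat_pair u)) := nat_involution_check.
case/and4P=> _ _ /eqnP eq1 /eqnP eq2.
by rewrite [LHS]surjective_pairing eq1 eq2 -surjective_pairing.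
Qed.

Lemma adj_involution u v : adj (involution u) (involution v) = adj u v.
Proof.
rewrite /adj /= !nat_pair_involution; apply/eqbP.
have /allP/(_ _ (mem_nat_pair u)) := nat_adj_involution_check.
by move=> /allP/(_ _ (mem_nat_pair v)).
Qed.

Lemma rotation_inj : injective rotation.
Proof.
move=> [a b] [c d] eq_ab; have /= -> := congr1 fst eq_ab.
by have /= /ordS_inj-> := congr1 snd eq_ab.
Qed.

Lemma nth_doubled (r : seq bool) i :
  i < size r + size r -> nth false (r ++ r) i = nth false r (i %% size r).
Proof.
move=> lt_i; rewrite nth_cat; case: ltnP => [lt_ir|le_ri]; first by rewrite modn_small.
by rewrite -[in RHS](subnK le_ri) modnDr modn_small ?ltn_subLR.
Qed.

Lemma adjE u v : adj u v =
  nth false (adjacency_row (nth [::] base_blocks u.1) (nth [::] base_blocks v.1))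
    ((v.2 + 13 - u.2) %% 13).
Proof.
rewrite /adj /= /nat_adj /= /adjacency_table.
rewrite (nth_map [::]) ?(nth_map [::]) //; cbv zeta.
rewrite nth_doubled ?size_map ?size_iota //.
(* Adding 13 first keeps the subtraction from truncating; the index is then below 26, the length of
   the doubled row. *)
by apply: leq_ltn_trans (leq_subr _ _) _; rewrite ltn_add2r.
Qed.

Lemma adj_rotation u v : adj (rotation u) (rotation v) = adj u v.
Proof.
rewrite !adjE /=; congr nth; move: (ltn_ord u.2) (ltn_ord v.2).
by move: (nat_of_ord u.2) (nat_of_ord v.2) => b d; lia.
Qed.

(* The orbits of [rotation] are numbered so that [involution] leads from each of
   them to an earlier one. *)
Lemma orbit_induction (P : vertex -> Prop) :
  P vertex0 -> (forall u, P u -> P (rotation u)) ->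
  (forall u, P u -> P (involution u)) -> forall u, P u.
Proof.
move=> P0 Prot Pinv.
have orbitP a b b' : P (a, b) -> P (a, b').
  move=> Pab; have Piter n : P (a, inord ((b + n) %% 13)).
    elim: n => [|n /Prot]; first by rewrite addn0 modn_small // inord_val.
    congr (P (_, _)); apply: val_inj; rewrite /= !inordK ?ltn_pmod //.
    by rewrite -addn1 modnDml addn1 addnS.
  (* This many rotations carry [b] to [b'] modulo 13. *)
  have := Piter (b' + 13 - b); congr (P (_, _)); apply: val_inj => /=.
  rewrite inordK ?ltn_pmod //; move: (ltn_ord b) (ltn_ord b').
  by move: (nat_of_ord b) (nat_of_ord b') => m m'; lia.
case=> [[a lt_a] b]; elim/ltn_ind: a lt_a b => -[|a] IHa lt_a b.
  have <- : ord0 = Ordinal lt_a by apply: val_inj.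
  exact: orbitP P0.
have /allP/(_ a.+1) := nat_involution_descent_check.
rewrite mem_iota => /(_ lt_a) /hasP[b' ]; rewrite mem_iota => lt_b' lt_inv.
apply: (@orbitP _ (Ordinal (lt_b' : b' < 13))).
(* The chosen vertex is the image of its own image, which lies in an earlier orbit. *)
rewrite -[X in P X]involutionK; apply: Pinv.
move: lt_inv (nat_pair_involution (Ordinal lt_a, Ordinal (lt_b' : b' < 13))).
case: (involution _) => -[c lt_c] d lt_inv /(congr1 fst) /= eq_c.
by apply: IHa; rewrite eq_c.
Qed.

(** Automorphisms move both arguments at once, so symmetry at [vertex0] spreads along
    [orbit_induction]. *)
Lemma adj_sym : symmetric adj.
Proof.
suff adjC c v : adj v (c, ord0) = adj (c, ord0) v.
  move=> u v; elim/orbit_induction: v u => [u|v IHv u|v IHv u].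
  - exact: adjC.
  - by rewrite -(f_finv rotation_inj u) !adj_rotation.
  - by rewrite -(involutionK u) !adj_involution.
apply/eqbP; have /allP/(_ c) := nat_adj_sym_check.
by rewrite mem_iota => /(_ (ltn_ord c)) /allP/(_ _ (mem_nat_pair v)).
Qed.

Lemma common_neighborsE u v : common_neighbors adj u v =
  if u == v then 100 else if adj u v then 36 else 20.
Proof.
elim/orbit_induction: u v => [v|u IHu v|u IHu v]; last 2 first.
- rewrite -(f_finv rotation_inj v) adj_rotation (inj_eq rotation_inj).
  by rewrite (common_neighbors_aut rotation_inj adj_rotation).
- rewrite -(involutionK v) adj_involution (inj_eq (inv_inj involutionK)).
  by rewrite (common_neighbors_aut (inv_inj involutionK) adj_involution).
have /allP/(_ _ (mem_nat_pair v)) := nat_common_neighbors0_check.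
move/eqnP; rewrite nat_neighbors0E count_map count_filter.
rewrite /common_neighbors card_count_vertices => cnt.
transitivity (count (predI (adj v) (adj vertex0)) vertices).
  by apply: eq_count => w; rewrite inE andbC.
have -> : (vertex0 == v) = eqn (nat_pair v).1 0 && eqn (nat_pair v).2 0.
  by rewrite eq_sym -(inj_eq nat_pair_inj).
exact: cnt.
Qed.

Lemma adj_irrefl : irreflexive adj.
Proof.
elim/orbit_induction=> [|u|u]; rewrite ?adj_rotation ?adj_involution //.
Qed.

(** By transitivity a nonempty clique may be assumed to contain [vertex0]; its other members are
    then neighbors of [vertex0]. Passing to preimages under an automorphism keeps cliques and their
    size. *)
Lemma clique_card (K : {set vertex}) : is_clique adj K -> #|K| <= 5.
Proof.
have [->|[u uK]] := set_0Vmem K; first by rewrite cards0.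
elim/orbit_induction: u K uK => [K uK clK|u IHu K uK clK|u IHu K uK clK].
- rewrite (cardsD1 vertex0) uK ltnS.
  have := nat_cliques0_check; rewrite nat_neighbors0E cliques_le_map -/adj.
  move=> /cliques_le_card; apply.
  + by rewrite filter_uniq ?vertices_uniq.
  + move=> v; rewrite !inE mem_filter mem_vertices andbT => /andP[v0 vK].
    by apply: clK; rewrite // eq_sym.
  + by move=> x y /setD1P[_ xK] /setD1P[_ yK]; apply: clK.
- rewrite -(on_card_preimset (f := rotation)).
    by apply: IHu; [rewrite inE | apply: is_clique_preim rotation_inj adj_rotation _ clK].
  by apply: onW_bij; apply: injF_bij; apply: rotation_inj.
- rewrite -(on_card_preimset (f := involution)).
    apply: IHu; first by rewrite inE.
    exact: is_clique_preim (inv_inj involutionK) adj_involution _ clK.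
  by apply: onW_bij; apply: inv_bij; apply: involutionK.
Qed.

(** * Linear algebra: ranks of projections and Gram matrices *)

Local Open Scope ring_scope.

Lemma mxtrace_idempotent (F : fieldType) n (P : 'M[F]_n) :
  P *m P = P -> \tr P = (\rank P)%:R.
Proof.
move=> PP; pose c := col_base P; pose r := row_base P.
have cr : c *m r = P by apply: mulmx_base.
suff rc : r *m c = 1%:M by rewrite -[X in \tr X]cr mxtrace_mulC rc mxtrace1.
(* In the rank factorization [P = c *m r], idempotence reads [c *m (r *m c) *m r = c *m r]; both
   outer factors can be cancelled. *)
apply: (row_full_inj (col_base_full P)).
apply: (row_free_inj (row_base_free P)) => /=.
have -> : c *m (r *m c) *m r = c *m r *m (c *m r) by rewrite !mulmxA.
by rewrite mulmx1 cr.
Qed.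

(** The rows of [X] span a space of dimension at most [d], and coordinates in an orthonormal basis
    preserve inner products. The induction is Gram-Schmidt: split off one direction [w] of the row
    space and project the rows to its orthogonal complement. *)
Lemma gram_lower_dim (R : rcfType) d m N (X : 'M[R]_(m, N)) :
  (\rank X <= d)%N -> exists Y : 'M[R]_(m, d), Y *m Y^T = X *m X^T.
Proof.
elim: d X => [|d IHd] X rkX.
  exists 0; move: rkX; rewrite leqn0 mxrank_eq0 => /eqP->.
  by rewrite !mul0mx.
have [->|/rowV0Pn[w wX w0]] := eqVneq X 0; first by exists 0; rewrite !mul0mx.
pose q := (w *m w^T) 0 0.
have wwE : w *m w^T = q%:M by apply: mx11_scalar.
have q_gt0 : 0 < q.
  rewrite /q mxE; have [i wi0] : exists i, w 0 i != 0.
    apply/existsP; apply: contraNT w0 => /existsPn w0.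
    by apply/eqP/rowP => i; rewrite mxE; apply/eqP; have := w0 i; rewrite negbK.
  rewrite (bigD1 i) //= mxE ltr_wpDr //; last by rewrite -expr2 exprn_even_gt0.
  by apply: sumr_ge0 => j _; rewrite mxE -expr2 sqr_ge0.
have q0 : q != 0 by rewrite gt_eqF.
pose z := X *m w^T; pose X' := X - q^-1 *: (z *m w).
have X'w : X' *m w^T = 0.
  rewrite mulmxBl -scalemxAl -mulmxA wwE mul_mx_scalar scalerA mulVf //.
  by rewrite scale1r subrr.
have X'X : (X' <= X)%MS.
  by rewrite addmx_sub ?submx_refl // -scaleN1r !scalemx_sub //
    (submx_trans (submxMl _ _)).
(* The rank drops: [w] lies in the row space of [X], but in that of [X'] it would be orthogonal to
   itself. *)
have rkX' : (\rank X' <= d)%N.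
  rewrite -ltnS (leq_trans _ rkX) // ltn_neqAle mxrankS // andbT.
  apply/negP => /eqP eq_rk; have : (X <= X')%MS.
    by rewrite -(geq_leqif (mxrank_leqif_sup X'X)) eq_rk.
  move=> /(submx_trans wX) /submxP[D wD].
  by move: q_gt0; rewrite /q wD -mulmxA -wD X'w mulmx0 mxE ltxx.
have [Y' Y'E] := IHd _ rkX'.
change (exists Y : 'M[R]_(m, 1 + d), Y *m Y^T = X *m X^T).
exists (row_mx ((Num.sqrt q)^-1 *: z) Y').
rewrite tr_row_mx mul_row_col Y'E linearZ /= -scalemxAl -scalemxAr scalerA.
rewrite -invfM -expr2 sqr_sqrtr ?ltW //.
have -> : X' *m X'^T = X' *m X^T.
  by rewrite [X in _ *m X]linearB /= linearZ /= trmx_mul mulmxBr -scalemxAr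
    mulmxA X'w mul0mx scaler0 subr0.
have -> : z^T = w *m X^T by rewrite trmx_mul trmxK.
by rewrite mulmxBl -scalemxAl mulmxA addrC subrK.
Qed.

(** * Spherical sets that need many parts, and cones over them *)

Definition sqdist (n : nat) (x y : point n) : R :=
  \sum_(i < n) (x ord0 i - y ord0 i) ^+ 2.

(* The constraint [2 * r < D] on the squared radius [r] and squared diameter
   [D] is what makes the cone construction iterable. *)
Definition spherical_set_needing (n m : nat) : Prop :=
  exists (S : set (point n)) (c : point n) (r D : R),
    [/\ 0 <= r, 2 * r < D, forall x, S x -> sqdist x c = r,
        forall x y, S x -> S y -> sqdist x y <= D
      & forall (k : nat) (A : 'I_k -> set (point n)), (k < m)%N ->
          (forall x, S x -> exists i, A i x) ->
          exists i x y, [/\ S x, S y, A i x, A i y & sqdist x y = D]].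

Lemma edistE n (x y : point n) : edist x y = Num.sqrt (sqdist x y).
Proof. by []. Qed.

Lemma not_borsuk_partitionable (n m k : nat) :
  (1 < m)%N -> (k < m)%N -> spherical_set_needing n m ->
  ~ borsuk_partitionable n k.
Proof.
move=> m_gt1 lt_km [S [c [r [D [r_ge0 ltrD _ leD needS]]]]] /(_ S).
have D_gt0 : 0 < D by apply: le_lt_trans ltrD; rewrite mulr_ge0.
case.
- by exists (Num.sqrt D) => x y Sx Sy; rewrite edistE ler_wsqrtr ?leD.
(* The cover by the single part [S] yields two points at squared distance [D > 0], hence
   distinct. *)
- have [|_ [x [y [Sx Sy _ _ xyD]]]] := needS 1%N (fun=> S) m_gt1.
    by move=> x Sx; exists ord0.
  exists x, y; split=> //; split=> // eq_xy; move: D_gt0.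
  rewrite -xyD eq_xy /sqdist big1 ?ltxx // => i _.
  by rewrite subrr expr0n.
move=> A [_ coverA _ ltA].
have [i [x [y [_ _ Ax Ay xyD]]]] := needS k A lt_km coverA.
have := ltA i; rewrite ltNge => /negP; apply.
(* The diameter of [S] is at most [Num.sqrt D], which the part [A i] attains. *)
apply: (@le_trans _ _ (Num.sqrt D)%:E).
  apply: ge_ereal_sup => _ [u Su [v Sv <-]].
  by rewrite lee_fin edistE ler_wsqrtr ?leD.
by apply: ereal_sup_ubound; exists x => //; exists y => //; rewrite edistE xyD.
Qed.

Definition lift_point n (h : R) (x : point n) : point n.+1 :=
  \row_i (if unlift ord0 i is Some j then x ord0 j else h).

Lemma sqdist_lift n (h k : R) (x y : point n) :
  sqdist (lift_point h x) (lift_point k y) = (h - k) ^+ 2 + sqdist x y.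
Proof.
rewrite /sqdist big_ord_recl; congr (_ + _); first by rewrite !mxE unlift_none.
by apply: eq_bigr => i _; rewrite !mxE liftK.
Qed.

(* The apex lies at distance [sqrt D] from every point of [S], so the part that
   contains it contains no other point. *)
Lemma spherical_set_cone n m :
  spherical_set_needing n m -> spherical_set_needing n.+1 m.+1.
Proof.
case=> S [c [r [D [r_ge0 ltrD Sr leD needS]]]].
(* Height of the apex above [c], chosen so that [h ^+ 2 + r = D]. *)
pose h := Num.sqrt (D - r).
have h2 : h ^+ 2 = D - r by rewrite sqr_sqrtr //; lra.
have h_gt0 : 0 < h by rewrite sqrtr_gt0; lra.
(* Height of the new center, equidistant from the apex and from the points of [S]. *)
pose t := (D - 2 * r) / (2 * h).
have th : 2 * (t * h) = D - 2 * r by rewrite /t; field; rewrite gt_eqF.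
have eqr : t ^+ 2 + r = (h - t) ^+ 2 by rewrite sqrrB h2 -mulr_natl; lra.
pose p : point n.+1 := lift_point h c.
have sqC l (x y : point l) : sqdist x y = sqdist y x.
  by apply: eq_bigr => i _; rewrite -sqrrN opprB.
have sqxx l (x : point l) : sqdist x x = 0.
  by apply: big1 => i _; rewrite subrr expr0n.
have sqp x : S x -> sqdist p (lift_point 0 x) = D.
  by move=> Sx; rewrite sqdist_lift subr0 h2 sqC Sr //; lra.
have sq0 x y : sqdist (lift_point 0 x) (lift_point 0 y) = sqdist x y :> R.
  by rewrite sqdist_lift subrr expr0n add0r.
exists [set z | z = p \/ exists2 x, S x & z = lift_point 0 x]%classic.
exists (lift_point t c), (t ^+ 2 + r), D; split.
- by rewrite addr_ge0 ?sqr_ge0.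
(* As [4 * t ^+ 2 * (D - r) = (D - 2 * r) ^+ 2], the new inequality reduces to [D > 0]. *)
- have : (2 * (t * h)) ^+ 2 = (D - 2 * r) ^+ 2 by rewrite th.
  rewrite !exprMn h2 => t2; nra.
- move=> _ [->|[x Sx ->]]; first by rewrite sqdist_lift sqxx addr0 eqr.
  by rewrite sqdist_lift sub0r sqrrN Sr.
- move=> _ _ [->|[x Sx ->]] [->|[y Sy ->]].
  + by rewrite sqxx; lra.
  + by rewrite sqp.
  + by rewrite sqC sqp.
  + by rewrite sq0 leD.
case=> [|k] A lt_k coverA; first by have [|[]] := coverA p; [left|].
have [j Ajp] : exists j, A j p by apply: coverA; left.
have [[x [Sx Ajx]]|noA] := pselect (exists x, S x /\ A j (lift_point 0 x)).
  exists j, p, (lift_point 0 x); split=> //; [by left|by right; exists x|].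
  exact: sqp.
(* When the part [j] of the apex misses the base, the other [k] parts already cover it. *)
pose B i : set (point n) := fun x => A (lift j i) (lift_point 0 x).
have [|i [x [y [Sx Sy Bx By xyD]]]] := needS k B lt_k.
  move=> x Sx; have [|i Ai] := coverA (lift_point 0 x); first by right; exists x.
  have [eq_ij|ij] := eqVneq j i.
    by case: noA; exists x; rewrite eq_ij.
  by have [i' eq_i _] := unlift_some ij; exists i'; rewrite /B -eq_i.
exists (lift j i), (lift_point 0 x), (lift_point 0 y); rewrite sq0.
by split=> //; right; [exists x|exists y].
Qed.

(** * Euclidean representation of a strongly regular graph with parameters (416, 100, 36, 20) *)

Section G24Representation.
Variables (V : finType) (e : rel V).
Hypotheses (cardV : #|V| = 416%N) (e_sym : symmetric e) (e_irr : irreflexive e).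
Hypothesis common_e : forall u v, common_neighbors e u v =
  if u == v then 100%N else if e u v then 36%N else 20%N.

Section Gram.
Variable F : rcfType.

(* The adjacency matrix [A] has eigenvalues 100, 20 and -4, and [A + 4 I - J / 4]
   is 24 times the projection onto the eigenspace of 20, of dimension 65. *)
Definition shifted_adjacency (u v : V) : F :=
  (e u v)%:R + 4 * (u == v)%:R - 4^-1.

Local Notation c := shifted_adjacency.

Lemma sum_pred (P : pred V) : \sum_w (P w)%:R = #|P|%:R :> F.
Proof.
rewrite -sum1_card natr_sum [RHS]big_mkcond; apply: eq_bigr => w _.
by rewrite unfold_in; case: (P w).
Qed.

Lemma sum_edges u : \sum_w (e u w)%:R = 100 :> F.
Proof.
rewrite sum_pred; congr (_%:R); have := common_e u u; rewrite eqxx => <-.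
by apply: eq_card => w; rewrite !unfold_in /= andbb.
Qed.

Lemma sum_delta u (f : V -> F) : \sum_w (u == w)%:R * f w = f u.
Proof.
rewrite (bigD1 u) //= eqxx mul1r big1 ?addr0 // => w.
by rewrite eq_sym => /negbTE->; rewrite mul0r.
Qed.

(** In matrix form, [A^2 = 80 I + 16 A + 20 J]. *)
Lemma sum_common u v :
  \sum_w (e u w)%:R * (e v w)%:R = 80 * (u == v)%:R + 16 * (e u v)%:R + 20 :> F.
Proof.
under eq_bigr do rewrite -natrM mulnb.
rewrite (sum_pred [pred w | e u w && e v w]) -/(common_neighbors e u v) common_e.
by case: eqVneq => [->|_]; rewrite ?e_irr; last case: (e u v);
  rewrite /= ?mulr1n ?mulr0n; lra.
Qed.

Lemma c_sym u v : c u v = c v u.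
Proof. by rewrite /shifted_adjacency e_sym eq_sym. Qed.

Lemma sum_cc u v : \sum_w c u w * c v w = 24 * c u v.
Proof.
(* The product is expanded into terms whose sums over [w] are all known. *)
rewrite (eq_bigr (fun w => (e u w)%:R * (e v w)%:R
   + (4 * ((v == w)%:R * (e u w)%:R) + (4 * ((u == w)%:R * (e v w)%:R)
   + (16 * ((u == w)%:R * (v == w)%:R) + (- 4^-1 * (e u w)%:R
   + (- 4^-1 * (e v w)%:R + (- ((u == w)%:R * 1) + (- ((v == w)%:R * 1)
   + 16^-1))))))))); last first.
  move=> w _; rewrite /shifted_adjacency.
  move: (e u w)%:R (e v w)%:R (u == w)%:R (v == w)%:R.
  by move=> a b x z; field.
rewrite !big_split /= -!mulr_sumr !sumrN !sum_delta !sum_edges sum_common.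
rewrite sumr_const cardV -mulr_natr (e_sym v u) (eq_sym v u) /shifted_adjacency.
by field.
Qed.

(** The rows of [C] have Gram matrix [C *m C^T = 24 *: C], and the rank of [C] is the trace of the
    projection [C / 24], namely [416 * (15 / 4) / 24 = 65]. *)
Lemma gram_representation : exists y : V -> 'rV[F]_65,
  forall u v, \sum_i y u ord0 i * y v ord0 i = 24 * c u v.
Proof.
pose C : 'M[F]_#|V| := \matrix_(i, j) c (enum_val i) (enum_val j).
have CT : C^T = C by apply/matrixP=> i j; rewrite !mxE c_sym.
have CC : C *m C = 24 *: C.
  apply/matrixP=> i j; rewrite !mxE -sum_cc (reindex (@enum_val V predT)) /=.
    by apply: eq_bigr => l _; rewrite !mxE [c (enum_val l) _]c_sym.
  exact/onW_bij/enum_val_bij.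
have rkC : \rank C = 65%N.
  have : \tr (24^-1 *: C) = (\rank (24^-1 *: C))%:R.
    apply: mxtrace_idempotent; rewrite -scalemxAl -scalemxAr CC !scalerA.
    by congr (_ *: _); field.
  rewrite mxrank_scale_nz ?invr_eq0 ?pnatr_eq0 // mxtraceZ => eq_tr.
  apply/eqP; rewrite -(eqr_nat F) -eq_tr /mxtrace.
  rewrite (eq_bigr (fun=> 4 - 4^-1)); last first.
    by move=> i _; rewrite mxE /shifted_adjacency e_irr eqxx /= ?mulr0n ?mulr1n; lra.
  by rewrite sumr_const card_ord cardV -mulr_natr; apply/eqP; field.
have [Y YY] : exists Y : 'M[F]_(#|V|, 65), Y *m Y^T = C *m C^T.
  by apply: gram_lower_dim; rewrite rkC.
exists (fun u => row (enum_rank u) Y) => u v.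
have := congr1 (fun M : 'M__ => M (enum_rank u) (enum_rank v)) YY.
rewrite CT CC !mxE !enum_rankK => <-.
by apply: eq_bigr => i _; rewrite !mxE.
Qed.

End Gram.

(** Inner products are 90 on the diagonal, 18 for adjacent and -6 for other distinct pairs; the
    squared distances are [180 - 36] and [180 + 12]. *)
Lemma spherical_representation : exists y : V -> point 65,
  (forall u, sqdist (y u) 0 = 90) /\
  forall u v, sqdist (y u) (y v) = if u == v then 0 else if e u v then 144 else 192.
Proof.
have [y yE] := gram_representation R; exists y; split=> [u|u v].
  have := yE u u; rewrite /shifted_adjacency eqxx e_irr => yu.
  rewrite -[RHS](_ : 24 * (0 + 4 * 1 - 4^-1) = _); last by field.
  by rewrite -yu; apply: eq_bigr => i _; rewrite mxE subr0 expr2.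
rewrite /sqdist (eq_bigr (fun i => y u ord0 i * y u ord0 i
  + (y v ord0 i * y v ord0 i + - 2 * (y u ord0 i * y v ord0 i)))); last first.
  by move=> i _; ring.
rewrite !big_split /= -mulr_sumr !yE /shifted_adjacency !eqxx !e_irr.
by case: eqVneq => [->|_]; rewrite ?e_irr; last case: (e u v);
  rewrite /= ?mulr1n ?mulr0n; field.
Qed.

Lemma spherical_set_of_cliques :
  (forall K, is_clique e K -> (#|K| <= 5)%N) -> spherical_set_needing 65 84.
Proof.
move=> clique_le5; have [y [y0 yy]] := spherical_representation.
exists (range y), 0, 90, 192; split.
- by [].
- lra.
- by move=> _ [u _ <-].
- by move=> _ _ [u _ <-] [v _ <-]; rewrite yy; case: eqP => _; [|case: (e u v)]; lra.
move=> k A lt_k coverA; apply: contrapT => noA.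
pose K i : {set V} := [set u | `[< A i (y u) >]].
have clK i : (#|K i| <= 5)%N.
  apply: clique_le5 => u v; rewrite !inE => Au Av uv.
  apply: contrapT => nuv; apply: noA; exists i, (y u), (y v).
  split=> //.
  by rewrite yy (negbTE uv) (negbTE (introN idP nuv)).
(* At most 83 cliques of size at most 5 contain at most 415 of the 416 vertices. *)
suff : (#|V| <= \sum_i #|K i|)%N.
  have : (\sum_i #|K i| <= \sum_(i < k) 5)%N by apply: leq_sum.
  rewrite sum_nat_const card_ord cardV; lia.
(* Double counting: each vertex is counted at least once, by a part containing its point. *)
under eq_bigr do rewrite -sum1_card big_mkcond /=.
rewrite exchange_big /= -sum1_card; apply: leq_sum => u _.
have [|i Ai] := coverA (y u); first by exists u.
by rewrite (bigD1 i) //= inE asboolT.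
Qed.

End G24Representation.

(** * Iterated cones and the conclusion *)

Lemma spherical_set_G24 (n : nat) : (65 <= n)%N -> spherical_set_needing n (n + 19).
Proof.
move=> /subnK <-; elim: (n - 65)%N => [|m]; last exact: spherical_set_cone.
apply: (spherical_set_of_cliques _ adj_sym adj_irrefl common_neighborsE clique_card).
by rewrite card_prod !card_ord.
Qed.

(* f(321) >= 333, and f(n) > n+1 for all n >= 321. *)
Theorem theorem1 :
  (forall k : nat, (k < 333)%N -> ~ borsuk_partitionable 321 k) /\
  (forall n : nat, (321 <= n)%N ->
     forall k : nat, (k <= n.+1)%N -> ~ borsuk_partitionable n k).
Proof.
(* Both claims follow, since [321 + 19 = 340] exceeds 333 and [n + 1 < n + 19]. *)
suff not_part n k : (321 <= n)%N -> (k < n + 19)%N -> ~ borsuk_partitionable n k.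
  split=> [k lt_k|n le_n k le_k]; apply: not_part => //.
    exact: leq_trans lt_k _.
  by apply: leq_ltn_trans le_k _; rewrite -addn1 ltn_add2l.
move=> le_n lt_k; apply: (not_borsuk_partitionable _ lt_k).
  by rewrite (leq_trans _ (leq_addl _ _)).
by apply: spherical_set_G24; apply: leq_trans le_n.
Qed.
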